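(* Let $n$ and $k$ be positive integers with $k\geq 4$, and let $c:E(K_{2kn})\to [k]$ be an edge-coloring (not necessarily proper) of the complete graph $K_{2kn}$ such that the origin of $\mathbb{R}^k$ lies in the convex hull of the set $\{v(M):M\in\mathcal{M}\}$. Then there is a perfect matching $M$ of $K_{2kn}$ with $$f(M)\leq 13k^{\frac{11}{4}}n^{\frac{3}{4}}\sqrt{\ln(2k)}.$$
   Context: $\mathcal{M}$ denotes the set of all perfect matchings of $K_{2kn}$. For $M\in\mathcal{M}$ and $i\in[k]=\{1,\dots,k\}$, let $m_i(M)=|c^{-1}(i)\cap M|$ be the number of edges of $M$ of color $i$, let $v(M)=(m_1(M)-n,\ldots,m_k(M)-n)\in\mathbb{R}^k$, and let $f(M)=\|v(M)\|_1=\sum_{i=1}^k|m_i(M)-n|$. *)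

(* Defs.v *)
(* MathComp / MathComp-Analysis *)
From HB Require Import structures.
From mathcomp Require Import all_boot all_order all_algebra.
From mathcomp Require Import all_classical all_reals all_analysis.

Set Implicit Arguments.
Unset Strict Implicit.
Unset Printing Implicit Defensive.

Import Order.TTheory GRing.Theory Num.Theory.
Local Open Scope classical_set_scope.
Local Open Scope ring_scope.

Definition convex_hull (R : numDomainType) (E : lmodType R) (A : set E) :
  set E := smallest (@convex_set R E) A.

Definition l1norm (R : numDomainType) (k : nat) (x : 'rV[R]_k) : R :=
  \sum_(i < k) `|x ord0 i|.

(* The edges of the complete graph on V are all the 2-element sets of
   vertices. *)
Definition edge (V : finType) : finType := {e : {set V} | #|e| == 2%N}.

Definition perfect_matching (V : finType) (M : {set edge V}) : bool :=
  [forall x : V, #|[set e in M | x \in val e]%SET| == 1%N].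

Definition color_count (V : finType) (k : nat) (c : edge V -> 'I_k)
  (M : {set edge V}) (i : 'I_k) : nat := #|[set e in M | c e == i]%SET|.

Definition deviation (R : numDomainType) (V : finType) (k : nat)
  (c : edge V -> 'I_k) (n : nat) (M : {set edge V}) : 'rV[R]_k :=
  \row_(i < k) ((color_count c M i)%:R - n%:R).

(* Main.v *)
(* Let M minimise |v(M)|_2. As 0 lies in the convex hull, some perfect matching
   M' satisfies <v(M), v(M')> <= 0. Walk along the alternating cycles of M and
   M': from each vertex x follow L matching edges of M' (or the whole cycle, if
   it is shorter), and let M_x be M with this segment switched to M', the two
   free ends being joined by one new edge. Suitably weighted, the differences
   v(M_x) - v(M) add up to a multiple of v(M') - v(M), up to one boundary edge
   per long segment. Averaging |v(M_x)|_2 >= |v(M)|_2 over x gives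
   F^2 <= k^2 n (F / L + 8 L) for F = f(M), and L of order n^(1/4) suffices. *)
Require Import Defs.
From mathcomp Require Import all_boot all_order all_algebra.
From mathcomp Require Import all_classical all_reals all_analysis.
From mathcomp Require Import perm ring lra.

Set Implicit Arguments.
Unset Strict Implicit.
Unset Printing Implicit Defensive.

Import Order.TTheory GRing.Theory Num.Theory.
Local Open Scope classical_set_scope.
Local Open Scope ring_scope.

(** * Fixed-point-free involutions and the orbits of their composition *)

Section Involutions.
Context {V : finType}.
Implicit Types (s t p : V -> V) (x : V).

(** The partner map of a perfect matching: [s v] is the vertex matched with [v]. *)
Definition fpf_involution s := involutive s /\ forall v, s v != v.

Lemma fpf_involution_conj p (q : {perm V}) :
  fpf_involution p -> involutive q -> fpf_involution (fun v => q (p (q v))).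
Proof.
move=> [pK p_fpf] qK; split=> [v|v]; first by rewrite qK pK qK.
by rewrite (can2_eq qK qK).
Qed.

Section TwoInvolutions.
Context (s t : V -> V) (hs : fpf_involution s) (ht : fpf_involution t).
Let phi := s \o t.

Lemma comp_fpf_inj : injective phi.
Proof. exact: inj_comp (can_inj hs.1) (can_inj ht.1). Qed.

(** An alternating cycle splits into two orbits of [phi], exchanged by [t]. An equation at [x] for
    [m + 2] shrinks to one at [phi x] for [m], until [t] or [s] would have a fixed point. *)
Lemma comp_fpf_flip x m : t x != iter m phi x.
Proof.
have [[sK s_fpf] [tK t_fpf]] := (hs, ht).
elim/ltn_ind: m x => -[|[|m]] IH x; first exact: t_fpf.
  by rewrite /= eq_sym s_fpf.
apply/eqP => txE; case/eqP: (IH m (ltnW (ltnSn _)) (phi x)).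
apply: comp_fpf_inj; rewrite -[RHS]iterS -iterSr -txE.
by rewrite /phi /= tK sK.
Qed.

Lemma comp_fpf_iter_flip x i j : t (iter i phi x) != iter j phi x.
Proof.
have [[sK s_fpf] [tK t_fpf]] := (hs, ht).
(* [t] conjugates [phi] to its inverse. *)
have iterK n : iter n phi (t (iter n phi x)) = t x.
  by elim: n => [//|n IHn]; rewrite iterSr /= /phi /= tK sK.
apply/eqP => /(congr1 (iter i phi)); rewrite iterK -iterD => /eqP.
by apply/negP/comp_fpf_flip.
Qed.

Lemma iter_order_inj x i j : (i < order phi x)%N -> (j < order phi x)%N ->
  iter i phi x = iter j phi x -> i = j.
Proof.
by move=> il jl e; rewrite -(findex_iter il) e findex_iter.
Qed.

End TwoInvolutions.

(* Weighting the segment at x by the inverse of its length compensates for the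
   orbits of f that are shorter than L. *)
Lemma average_orbit_segments (R : numFieldType) (f : V -> V) (F : V -> R) L :
  injective f -> (0 < L)%N ->
  \sum_x (\sum_(m < minn L (order f x)) F (iter m f x)) /
           (minn L (order f x))%:R = \sum_y F y.
Proof.
move=> f_inj L_gt0; pose l x := minn L (order f x).
(* The segment length is constant on orbits, so for each fixed [m] the sum over [x] can be reindexed
   by the bijection [iter m f]. *)
have l_iter m x : l (iter m f x) = l x.
  rewrite /l; congr minn; elim: m => //= m IHm.
  by rewrite (order_id_cycle (cycle_orbit f_inj _)).
have l_gt0 x : (0 < l x)%N by rewrite leq_min L_gt0 order_gt0.
transitivity (\sum_x \sum_(m < L | (m < l (iter m f x))%N)
                 F (iter m f x) / (l (iter m f x))%:R).
  apply: eq_bigr => x _; rewrite mulr_suml.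
  under [RHS]eq_bigl do rewrite l_iter.
  rewrite [LHS](big_ord_widen L (fun m => F (iter m f x) / (l x)%:R)) ?geq_minl //.
  by apply: eq_bigr => m _; rewrite l_iter.
under eq_bigr do rewrite big_mkcond.
rewrite exchange_big /=.
transitivity (\sum_(m < L) \sum_y if (m < l y)%N then F y / (l y)%:R else 0).
  apply: eq_bigr => m _.
  have it_inj : injective (iter m f) by elim: (nat_of_ord m) => //= q IH; exact: inj_comp.
  by rewrite [RHS](reindex_inj it_inj).
rewrite exchange_big /=; apply: eq_bigr => y _.
rewrite -big_mkcond /= -(big_ord_widen L (fun=> F y / (l y)%:R)) ?geq_minl //.
by rewrite sumr_const card_ord -[_ *+ l y]mulr_natr divfK // pnatr_eq0 -lt0n.
Qed.

End Involutions.

(** * Color counts under a switch of two edges *)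

Section Colors.
Context (R : realType) (V : finType) (k : nat) (c : edge V -> 'I_k).
Implicit Types (s t p : V -> V) (x u v : V) (i : 'I_k).

(* None if u = v. *)
Definition pair_color u v : option 'I_k := omap c (insub [set u; v]%SET).

Definition has_color i u v : R := (pair_color u v == Some i)%:R.

(* Every edge {v, s v} is counted at both of its ends. *)
Definition color_sum s i : R := \sum_v has_color i v (s v).

Lemma has_colorC i u v : has_color i u v = has_color i v u.
Proof. by rewrite /has_color /pair_color finset.setUC. Qed.

Lemma has_color_sub_le1 i u v u' v' :
  `|has_color i u v - has_color i u' v'| <= 1.
Proof.
rewrite /has_color; case: (_ == _); case: (_ == _);
by rewrite ?subr0 ?sub0r ?subrr ?normrN ?normr1 ?normr0.
Qed.

Lemma sum_has_color_le1 u v : \sum_i has_color i u v <= 1.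
Proof.
rewrite /has_color; case: (pair_color u v) => [j|]; last first.
  by rewrite big1 ?ler01.
rewrite (bigD1 j) //= eqxx big1 ?addr0 // => i ij.
by rewrite (inj_eq Some_inj) eq_sym (negbTE ij).
Qed.

Lemma sum_has_color_sub_le2 u v u' v' :
  \sum_i `|has_color i u v - has_color i u' v'| <= 2.
Proof.
have -> : 2 = 1 + 1 :> R by [].
apply: le_trans (lerD (sum_has_color_le1 u v) (sum_has_color_le1 u' v')).
rewrite -big_split /=; apply: ler_sum => i _.
by apply: le_trans (ler_normB _ _) _; rewrite !ger0_norm.
Qed.

(** Only the terms at [a], [p a], [z] and [p z] change. The doubling comes from counting each
    removed or added edge at both ends. *)
Lemma color_sum_switch p a z i : fpf_involution p -> a != z -> p a != z ->
  let q := tperm a z in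
  color_sum (fun v => q (p (q v))) i = color_sum p i +
    (has_color i (p a) z + has_color i a (p z)
     - has_color i a (p a) - has_color i z (p z)) *+ 2.
Proof.
move=> [pK p_fpf] az paz q; rewrite /color_sum (reindex_inj (@perm_inj _ q)).
have qK : involutive q by move=> v; rewrite /q tpermK.
under eq_bigr do rewrite qK.
pose D u := has_color i (q u) (q (p u)) - has_color i u (p u).
have -> : \sum_u has_color i (q u) (q (p u)) =
   \sum_u has_color i u (p u) + \sum_u D u.
  by rewrite -big_split; apply: eq_bigr => u _; rewrite /D /=; ring.
congr (_ + _).
have pza : p z != a by rewrite (can2_eq pK pK) eq_sym.
rewrite (bigD1 a) // (bigD1 (p a)) ?p_fpf //=.
rewrite (bigD1 z) /=; last by rewrite eq_sym az eq_sym paz.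
rewrite (bigD1 (p z)) /=; last first.
  by rewrite pza p_fpf (inj_eq (can_inj pK)) eq_sym az.
rewrite big1 => [|u /andP[/andP[/andP[ua upa] uz] upz]]; last first.
  by rewrite /D !tpermD ?subrr // eq_sym // (can2_eq pK pK).
rewrite /D !pK /q tpermL tpermR !(tpermD (z := p a)) ?(tpermD (z := p z)) //;
  rewrite 1?eq_sym ?p_fpf //.
rewrite (has_colorC i z (p a)) (has_colorC i (p a) a) (has_colorC i (p z) a)
  (has_colorC i (p z) z).
by ring.
Qed.

(** * Switching along alternating cycles *)

Section Walk.
Context (s t : V -> V) (hs : fpf_involution s) (ht : fpf_involution t).
Let phi := s \o t.

(** [phi y] is the [s]-partner of [t y], so this trades the [s]-edge at [t y] for the [t]-edge
    there. *)
Let gain i y := has_color i y (t y) - has_color i (t y) (phi y).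

(* Conjugating p by the transposition of s x and t y, where y = p (s x),
   replaces the edges {s x, y}, {t y, p (t y)} by {y, t y}, {s x, p (t y)}; at
   the start of the last step of a cycle, {s x, y} is already {t y, y}. *)
Lemma switch_walk x j : (j < order phi x)%N ->
  exists p, [/\ fpf_involution p, p (s x) = iter j phi x,
    forall m, (j <= m)%N -> (m.+1 < order phi x)%N ->
      p (t (iter m phi x)) = iter m.+1 phi x
  & forall i, color_sum p i = color_sum s i +
      (\sum_(m < j) gain i (iter m phi x)
       + (has_color i (s x) (iter j phi x) - has_color i (s x) x)) *+ 2].
Proof.
have [[sK s_fpf] [tK t_fpf]] := (hs, ht).
have flip m n := comp_fpf_iter_flip hs ht x m n.
(* [s x] is the image under [t] of the last point of the orbit, hence lies outside the orbit. *)
have sx m : s x != iter m phi x.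
  have <- : t (iter (order phi x).-1 phi x) = s x.
    apply: (can_inj sK); rewrite sK -[LHS]/(phi (iter _ _ _)) -iterS.
    by rewrite orderSpred (iter_order (comp_fpf_inj hs ht)).
  exact: flip.
elim: j => [|j IHj] jlt.
  exists s; split=> // i.
  by rewrite big_ord0 subrr addr0 mul0rn addr0.
have [p [hp pa pm pcnt]] := IHj (ltnW jlt).
set y := iter j phi x in pa pcnt; set a := s x in sx pa pcnt *.
(* Ahead of the walk, [p] still agrees with [s]. *)
have pz : p (t y) = iter j.+1 phi x by rewrite pm.
(* The last point of the orbit must be excluded: its image under [t] is [s x]. *)
have tym m : (m.+1 < order phi x)%N -> a != t (iter m phi x).
  move=> mlt; apply/eqP => /(congr1 s); rewrite /a sK => e.
  have : 0%N = m.+1.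
    by apply: (@iter_order_inj _ s t x) => //; exact: order_gt0.
  by [].
have az : a != t y by exact: tym.
have itz m : t y != iter m phi x by exact: flip.
exists (fun v => tperm a (t y) (p (tperm a (t y) v))); split.
- by apply: fpf_involution_conj => // v; rewrite tpermK.
- by rewrite tpermL pz tpermD.
- move=> m jm mlt.
  have tyz : t y != t (iter m phi x).
    rewrite (inj_eq (can_inj tK)); apply/eqP => e.
    have jE : j = m by apply: (@iter_order_inj _ s t x) => //; exact: ltnW.
    by rewrite -jE ltnn in jm.
  by rewrite (tpermD (tym m mlt) tyz) (pm m (ltnW jm) mlt) tpermD.
- move=> i; rewrite color_sum_switch // pa; last by rewrite eq_sym.
  rewrite pcnt big_ord_recr /= pz -/y /gain -[iter j.+1 phi x]/(phi y).
  by ring.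
Qed.

Lemma switch_segment x L : (0 < L)%N ->
  exists2 p, fpf_involution p & forall i, color_sum p i = color_sum s i +
      (\sum_(m < minn L (order phi x)) gain i (iter m phi x)
       + (L < order phi x)%:R *
         (has_color i (s x) (iter L phi x) - has_color i (s x) x)) *+ 2.
Proof.
move=> L_gt0; have [Llt|ordL] := ltnP L (order phi x).
  have [p [hp _ _ pcnt]] := switch_walk Llt.
  by exists p => // i; rewrite mul1r; exact: pcnt.
(* One step fewer closes the whole orbit: the closing edge is then itself the last [t]-edge, and no
   boundary term remains. *)
have lt : ((order phi x).-1 < order phi x)%N by rewrite orderSpred.
have [p [hp _ _ pcnt]] := switch_walk lt.
exists p => // i; rewrite pcnt mul0r addr0 -[in RHS]orderSpred big_ord_recr /=.
set y := iter _ phi x; have ey : phi y = x.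
  by rewrite /y -iterS orderSpred (iter_order (comp_fpf_inj hs ht)).
have ety : t y = s x by rewrite -[in RHS]ey /phi /= hs.1.
by rewrite /gain ey ety has_colorC.
Qed.

(** The hypothesis on [w] says that no switch lowers the squared norm of [v]. It is applied to the
    segment at each [x], divided by the segment length and summed over [x]. *)
Lemma descent_bound (v : 'I_k -> R) L : (0 < L)%N ->
  (forall p w, fpf_involution p ->
     (forall i, color_sum p i = color_sum s i + w i *+ 2) ->
     0 <= (\sum_i v i * w i) *+ 2 + \sum_i w i ^+ 2) ->
  (\sum_i v i * (color_sum s i - color_sum t i)) *+ 2 <=
    #|V|%:R * ((\sum_i `|v i|) *+ 2 / L%:R + 16 * L%:R).
Proof.
move=> L_gt0 hmin; set F := \sum_i `|v i|.
pose l x := minn L (order phi x).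
have l_gt0 x : (0 < l x)%N by rewrite leq_min L_gt0 order_gt0.
have lR x : 0 < (l x)%:R :> R by rewrite ltr0n.
have LR : 0 < L%:R :> R by rewrite ltr0n.
have F0 : 0 <= F by exact: sumr_ge0.
pose S x i := \sum_(m < l x) gain i (iter m phi x).
pose b x i := (L < order phi x)%:R *
   (has_color i (s x) (iter L phi x) - has_color i (s x) x).
have key x : 0 <= (\sum_i v i * (S x i / (l x)%:R)) *+ 2
                  + (F *+ 2 / L%:R + 16 * L%:R).
  have [p hp pcnt] := switch_segment x L_gt0.
  have := hmin _ _ hp pcnt; rewrite -/(l x).
  have -> : \sum_i v i * (\sum_(m < l x) gain i (iter m phi x)
       + (L < order phi x)%:R *
         (has_color i (s x) (iter L phi x) - has_color i (s x) x))
    = \sum_i v i * S x i + \sum_i v i * b x i.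
    by rewrite -big_split; apply: eq_bigr => i _; rewrite mulrDr.
  (* A segment with a boundary term has length exactly [L]. *)
  have vb : \sum_i v i * b x i <= (l x)%:R * (F / L%:R).
    rewrite /b; case: ltnP => [Llt|ordL]; last first.
      rewrite big1 => [|i _]; last by rewrite mul0r mulr0.
      by rewrite mulr_ge0 ?divr_ge0.
    have -> : l x = L by exact: (minn_idPl (ltnW Llt)).
    rewrite mulrCA divff ?gt_eqF // mulr1.
    apply: ler_sum => i _; rewrite mul1r.
    apply: le_trans (ler_norm _) _; rewrite normrM ler_piMr //.
    exact: has_color_sub_le1.
  (* Each step contributes at most 2 and the boundary at most 2; [2 l + 2 <= 4 l] since [l >= 1]. *)
  have w1 : \sum_i `|S x i + b x i| <= 4 * (l x)%:R.
    have h1 : \sum_i `|S x i| <= 2 * (l x)%:R.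
      apply: le_trans (_ : \sum_i \sum_(m < l x) `|gain i (iter m phi x)| <= _).
        by apply: ler_sum => i _; exact: ler_norm_sum.
      rewrite exchange_big /=.
      apply: le_trans (_ : \sum_(m < l x) 2 <= _).
        by apply: ler_sum => m _; exact: sum_has_color_sub_le2.
      by rewrite sumr_const card_ord mulr_natr.
    have h2 : \sum_i `|b x i| <= 2.
      apply: le_trans (sum_has_color_sub_le2 (s x) (iter L phi x) (s x) x).
      apply: ler_sum => i _; rewrite /b.
      by case: ltnP => _; rewrite ?mul1r ?mul0r ?normr0.
    apply: le_trans (_ : \sum_i (`|S x i| + `|b x i|) <= _).
      by apply: ler_sum => i _; exact: ler_normD.
    rewrite big_split /=.
    have : 1 <= (l x)%:R :> R by rewrite ler1n.
    lra.
  (* Of the square [16 l ^ 2], one factor [l] is kept to cancel the weight and the other is bounded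
     by [L]. *)
  have w2 : \sum_i (S x i + b x i) ^+ 2 <= (l x)%:R * (16 * L%:R).
    apply: le_trans (_ : (\sum_i `|S x i + b x i|) ^+ 2 <= _).
      rewrite expr2 mulr_suml; apply: ler_sum => i _.
      rewrite -real_normK ?num_real // expr2 ler_wpM2l //.
      by rewrite (bigD1 i) //= lerDl sumr_ge0.
    apply: le_trans (_ : (4 * (l x)%:R) ^+ 2 <= _).
      by rewrite lerXn2r ?nnegrE ?mulr_ge0 ?sumr_ge0.
    have : (l x)%:R <= L%:R :> R by rewrite ler_nat geq_minl.
    have := lR x; nra.
  move=> h; have {h} : 0 <= ((\sum_i v i * S x i) *+ 2
      + (l x)%:R * (F *+ 2 / L%:R + 16 * L%:R)) / (l x)%:R.
    rewrite divr_ge0 //.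
    have -> : (l x)%:R * (F *+ 2 / L%:R + 16 * L%:R) =
      ((l x)%:R * (F / L%:R)) *+ 2 + (l x)%:R * (16 * L%:R) by ring.
    move: h w2; rewrite /S /b; lra.
  rewrite mulrDl mulrAC divff ?gt_eqF // mul1r mulrnAl mulr_suml.
  by under eq_bigr do rewrite -mulrA.
have : 0 <= \sum_x ((\sum_i v i * (S x i / (l x)%:R)) *+ 2
                  + (F *+ 2 / L%:R + 16 * L%:R)) by exact: sumr_ge0.
rewrite big_split /= sumr_const -mulr_natl sumrMnl exchange_big /=.
(* The weighted segments cover each [gain i y] exactly once; reindexing by [t] turns the subtracted
   terms into the color sum of [s]. *)
have -> : \sum_i \sum_x v i * (S x i / (l x)%:R) =
    - \sum_i v i * (color_sum s i - color_sum t i).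
  rewrite -sumrN; apply: eq_bigr => i _; rewrite -mulr_sumr -mulrN opprB.
  congr (_ * _); rewrite average_orbit_segments //; last exact: comp_fpf_inj.
  rewrite /gain sumrB; congr (_ - _).
  by rewrite [RHS](reindex_inj (can_inj ht.1)).
rewrite mulNrn; lra.
Qed.

End Walk.
End Colors.

(** * Translation between perfect matchings and involutions *)

Section Matchings.
Context (R : realType) (V : finType) (k : nat) (c : edge V -> 'I_k).

Lemma pair_color_edge (e : edge V) u v :
  val e = [set u; v]%SET -> pair_color c u v = Some (c e).
Proof. by move=> eE; rewrite /pair_color -eE valK. Qed.

Lemma perfect_matching_edge_unique (M : {set edge V}) (e e' : edge V) v :
  perfect_matching M -> e \in M -> e' \in M -> v \in val e -> v \in val e' ->
  e = e'.
Proof.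
move=> /forallP/(_ v)/cards1P[e0 eE] eM e'M ve ve'.
have in0 d : d \in M -> v \in val d -> d = e0.
  by move=> dM vd; apply/set1P; rewrite -eE inE dM.
by rewrite (in0 e) // (in0 e').
Qed.

(** Double counting of incidences: an edge has two ends, and a vertex lies on exactly one edge of
    [M]. *)
Lemma color_sum_matching (M : {set edge V}) s i : perfect_matching M ->
  (forall v, exists2 e : edge V, e \in M & val e = [set v; s v]%SET) ->
  color_sum R c s i = (color_count c M i)%:R *+ 2.
Proof.
move=> hM hs.
transitivity (\sum_v \sum_(e in [set e in M | c e == i]%SET)
                (v \in val e)%:R : R).
  apply: eq_bigr => v _; have [e eM eE] := hs v.
  have ve : v \in val e by rewrite eE !inE eqxx.
  rewrite /has_color (pair_color_edge eE) (inj_eq Some_inj).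
  have other d : d \in M -> d != e -> v \in val d = false.
    move=> dM de; apply/negbTE/negP => vd.
    by rewrite (perfect_matching_edge_unique hM dM eM vd ve) eqxx in de.
  case: (eqVneq (c e) i) => ci.
    rewrite (bigD1 e) ?inE ?eM ?ci ?eqxx //= ve big1 ?addr0 // => d.
    by rewrite inE => /andP[/andP[dM _] de]; rewrite other.
  rewrite big1 // => d; rewrite inE => /andP[dM /eqP cd].
  rewrite other //; apply/eqP => de; by rewrite -de cd eqxx in ci.
rewrite exchange_big /=.
transitivity (\sum_(e in [set e in M | c e == i]%SET) 2 : R).
  apply: eq_bigr => e _; rewrite -natr_sum; congr _%:R.
  apply: etrans (eqP (valP e)); rewrite -sum1_card [RHS]big_mkcond.
  by apply: eq_bigr => v _; case: (v \in val e).
by rewrite sumr_const /color_count -[in RHS]mulr_natr -[LHS]mulr_natl.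
Qed.

Lemma perfect_matching_partner (M : {set edge V}) : perfect_matching M ->
  exists2 s : V -> V, fpf_involution s &
    forall v, exists2 e : edge V, e \in M & val e = [set v; s v]%SET.
Proof.
move=> hM.
have ex v : exists u, u != v /\
    exists2 e : edge V, e \in M & val e = [set v; u]%SET.
  have /cards1P[e eE] := forallP hM v.
  have : e \in [set e in M | v \in val e]%SET by rewrite eE inE.
  rewrite inE => /andP[eM ve].
  have /cards2P[a [b [ab eab]]] := valP e.
  move: ve; rewrite eab !inE => /orP[] /eqP ->.
    by exists b; split; [rewrite eq_sym | exists e].
  by exists a; split => //; exists e => //; rewrite eab finset.setUC.
have [s hs] := choice ex.
exists s; last by move=> v; have [] := hs v.
split=> [v|v]; last by have [] := hs v.
have [sv [e eM eE]] := hs v; have [ssv [e' e'M e'E]] := hs (s v).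
have ee : e = e'.
  apply: (perfect_matching_edge_unique (v := s v) hM) => //;
  by rewrite ?eE ?e'E !inE eqxx ?orbT.
have : s (s v) \in val e by rewrite ee e'E !inE eqxx orbT.
by rewrite eE !inE (negbTE ssv) orbF => /eqP.
Qed.

Lemma fpf_involution_matching s : fpf_involution s ->
  exists2 M : {set edge V}, perfect_matching M &
    forall v, exists2 e : edge V, e \in M & val e = [set v; s v]%SET.
Proof.
move=> [sK s_fpf].
have /choice[E EE] v : exists e : edge V, val e = [set v; s v]%SET.
  have ed : #|[set v; s v]%SET| == 2%N by rewrite cards2 (eq_sym v) s_fpf.
  by exists (exist _ [set v; s v]%SET ed).
exists [set E v | v : V]%SET; last by move=> v; exists (E v) => //; exact: imset_f.
apply/forallP => v; apply/cards1P; exists (E v); apply/setP => e.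
rewrite !inE; apply/andP/eqP => [[/imsetP[u _ ->]]|->]; last first.
  by split; [exact: imset_f | rewrite EE !inE eqxx].
rewrite EE !inE => /orP[] /eqP -> //.
by apply: val_inj; rewrite /= !EE sK finset.setUC.
Qed.

End Matchings.

(** * Convexity and the minimising matching *)

Lemma convex_hull_halfspace (R : realType) (k : nat) (A : set 'rV[R]_k)
    (v : 'I_k -> R) :
  convex_hull A 0 -> exists2 x, A x & \sum_i v i * x ord0 i <= 0.
Proof.
move=> hA; apply: contrapT => nex.
(* If no such point existed, this open half-space would contain [A]; being convex it would contain
   the hull, yet it misses the origin. *)
pose H : set 'rV[R]_k := [set x | 0 < \sum_i v i * x ord0 i].
suff : H 0 by rewrite /H /= big1 ?ltxx // => i _; rewrite mxE mulr0.
apply: hA; split => [x y l|x Ax] /=; last first.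
  by rewrite /H /= ltNge; apply/negP => le0; apply: nex; exists x.
rewrite !inE /H /= => x0 y0.
have -> : \sum_i v i * (conv l (x : convex_lmodType _) y : 'rV[R]_k) ord0 i =
    l%:num * (\sum_i v i * x ord0 i) + (1 - l%:num) * (\sum_i v i * y ord0 i).
  rewrite !mulr_sumr -big_split /=; apply: eq_bigr => i _.
  by rewrite !mxE /unstable.onem; ring.
have : 0 <= l%:num :> R by [].
have : l%:num <= 1 :> R by [].
by have [] := leP (\sum_i v i * x ord0 i) (\sum_i v i * y ord0 i); nra.
Qed.

(** Cauchy-Schwarz against the all-ones vector, read off from the sum of all squared differences. *)
Lemma sqr_sum_le (R : realType) (k : nat) (v : 'I_k -> R) :
  (\sum_i v i) ^+ 2 <= k%:R * \sum_i v i ^+ 2.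
Proof.
have : 0 <= \sum_i \sum_j (v i - v j) ^+ 2.
  by apply: sumr_ge0 => i _; apply: sumr_ge0 => j _; exact: sqr_ge0.
have -> : \sum_i \sum_j (v i - v j) ^+ 2 =
    (k%:R * (\sum_i v i ^+ 2)) *+ 2 - (\sum_i v i) ^+ 2 *+ 2.
  transitivity (\sum_i (v i ^+ 2 *+ k + \sum_j v j ^+ 2
                        - (v i * \sum_j v j) *+ 2)).
    apply: eq_bigr => i _; rewrite mulr_sumr -sumrMnl.
    have -> : v i ^+ 2 *+ k = \sum_(j < k) v i ^+ 2 by rewrite sumr_const card_ord.
    rewrite -big_split -sumrB; apply: eq_bigr => j _ /=; ring.
  rewrite sumrB big_split /= !sumrMnl sumr_const card_ord -mulr_suml.
  by rewrite -mulr_natl; ring.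
lra.
Qed.

Lemma almost_balanced_matching (R : realType) (V : finType) (k n : nat)
    (c : edge V -> 'I_k) L : (0 < L)%N ->
  convex_hull
    [set deviation R c n M | M in [set M | perfect_matching M]] 0 ->
  exists2 M : {set edge V}, perfect_matching M &
    let F := l1norm (deviation R c n M) in
    2 * F ^+ 2 <= (k * #|V|)%:R * (F / L%:R + 8 * L%:R).
Proof.
move=> L_gt0 hull0.
pose dev (M : {set edge V}) i : R := (color_count c M i)%:R - n%:R.
(* The zero functional serves only to produce some perfect matching, so that a minimiser exists. *)
have [_ [M0 hM0 _] _] := convex_hull_halfspace (fun=> 0) hull0.
pose Phi M := \sum_i dev M i ^+ 2.
case: (arg_minP Phi hM0) => M hM Mmin.
have [_ [M' hM' <-] dev0] := convex_hull_halfspace (dev M) hull0.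
have [s hs sM] := perfect_matching_partner hM.
have [t ht tM'] := perfect_matching_partner hM'.
exists M => // F.
have FE : F = \sum_i `|dev M i| by apply: eq_bigr => i _; rewrite mxE.
have := descent_bound (R := R) (c := c) hs ht (v := dev M) L_gt0.
have hmin p w : fpf_involution p ->
     (forall i, color_sum R c p i = color_sum R c s i + w i *+ 2) ->
     0 <= (\sum_i dev M i * w i) *+ 2 + \sum_i w i ^+ 2.
  move=> hp pw; have [N hN pN] := fpf_involution_matching hp.
  have wE i : dev N i = dev M i + w i.
    have := pw i; rewrite (color_sum_matching R c i hN pN).
    rewrite (color_sum_matching R c i hM sM) /dev => e; lra.
  have := Mmin _ hN; rewrite /Phi -subr_ge0 -sumrB -sumrMnl -big_split /=.
  congr (0 <= _); apply: eq_bigr => i _; rewrite wE; ring.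
move=> /(_ hmin).
(* Color sums are twice the color counts and [n] cancels; by [dev0] the subtracted inner product is
   at most 0. *)
have -> : \sum_i dev M i * (color_sum R c s i - color_sum R c t i) =
    (Phi M) *+ 2 - (\sum_i dev M i * (deviation R c n M') ord0 i) *+ 2.
  rewrite -!sumrMnl -sumrB; apply: eq_bigr => i _.
  rewrite (color_sum_matching R c i hM sM) (color_sum_matching R c i hM' tM') mxE.
  rewrite /dev; ring.
rewrite -FE => H.
have : F ^+ 2 <= k%:R * Phi M.
  rewrite FE; apply: le_trans (sqr_sum_le _) _.
  by rewrite ler_wpM2l //; apply: ler_sum => i _; rewrite real_normK ?num_real.
move=> FPhi; apply: le_trans (_ : k%:R * (2 * Phi M) <= _).
  by rewrite [leRHS]mulrCA; apply: ler_wpM2l.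
rewrite natrM -mulrA ler_wpM2l //.
have -> : #|V|%:R * (F / L%:R + 8 * L%:R) =
  (#|V|%:R * (F *+ 2 / L%:R + 16 * L%:R)) / 2.
  by field; rewrite pnatr_eq0 -lt0n.
lra.
Qed.

(** * Numerical estimates and the final bound *)

Lemma half_le_sqrt_ln (R : realType) (x : R) :
  2 <= x -> 1 / 2 <= Num.sqrt (ln x).
Proof.
move=> x2.
have x0 : 0 < x by lra.
(* From [1 + y <= expR y] at [y = - 1 / 2], which gives [expR (1 / 2) <= 2]. *)
have e2 : expR (1 / 2) <= x.
  apply: le_trans x2; have := expR_ge1Dx (- (1 / 2 : R)).
  rewrite expRN => h; have e0 := expR_gt0 (1 / 2 : R).
  have : expR (1 / 2) * (expR (1 / 2))^-1 = 1 :> R by rewrite divff ?gt_eqF.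
  nra.
have l2 : 1 / 2 <= ln x.
  by rewrite -[1 / 2]expRK ler_ln ?posrE ?expR_gt0.
have := sqr_sqrtr (le_trans (ltac:(lra) : 0 <= 1 / 2) l2).
have := sqrtr_ge0 (ln x); nra.
Qed.

Lemma sqr_bound_le (R : realFieldType) (k r L F : R) : 4 <= k -> 1 <= r ->
  r <= L -> L <= 2 * r -> 0 <= F ->
  F ^+ 2 <= k ^+ 2 * r ^+ 4 * (F / L + 8 * L) -> F <= 2 * k ^+ 2 * r ^+ 3.
Proof.
move=> k4 r1 rL L2r F0 hF.
have r0 : 0 < r by lra.
have L0 : 0 < L by lra.
(* The two terms on the right are at most [A * F] and [C ^+ 2], and [C <= A] because [4 <= k]. So
   [F > 2 A] would give [F ^+ 2 > A * F + A ^+ 2], a contradiction. *)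
pose A := k ^+ 2 * r ^+ 3; pose C := 4 * k * r ^+ 3.
have CA : C <= A.
  by apply: ler_wpM2r; [rewrite exprn_ge0 // ltW | nra].
have C0 : 0 < C by rewrite /C !mulr_gt0 ?exprn_gt0 //; lra.
have bound : F ^+ 2 <= A * F + C ^+ 2.
  apply: le_trans hF _; rewrite mulrDr; apply: lerD.
    have -> : A * F = k ^+ 2 * r ^+ 4 * (F / r) by rewrite /A; field; lra.
    apply: ler_wpM2l; first by rewrite mulr_ge0 ?exprn_ge0 //; lra.
    by apply: ler_wpM2l => //; rewrite lef_pV2 ?posrE.
  have -> : C ^+ 2 = k ^+ 2 * r ^+ 4 * (16 * (r * r)) by rewrite /C; ring.
  apply: ler_wpM2l; first by rewrite mulr_ge0 ?exprn_ge0 //; lra.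
  nra.
have -> : 2 * k ^+ 2 * r ^+ 3 = A + A by rewrite /A; ring.
rewrite leNgt; apply/negP => AF; nra.
Qed.

Theorem theorem4 (R : realType) (n k : nat) (n_gt0 : (0 < n)%N)
  (k_ge4 : (4 <= k)%N) (c : edge 'I_(2 * k * n) -> 'I_k)
  (hull0 : convex_hull
             [set deviation R c n M | M in [set M | perfect_matching M]] 0) :
  exists2 M : {set edge 'I_(2 * k * n)},
    perfect_matching M &
    l1norm (deviation R c n M) <=
      13 * k%:R `^ (11 / 4) * n%:R `^ (3 / 4) * Num.sqrt (ln (2 * k%:R)).
Proof.
pose r : R := n%:R `^ (1 / 4).
have n1 : 1 <= n%:R :> R by rewrite ler1n.
have k4 : 4 <= k%:R :> R by rewrite ler_nat.
have r1 : 1 <= r by rewrite /r -[leLHS](powRr0 n%:R); apply: ler_powR => //; lra.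
have rpow m : n%:R `^ (m%:R / 4) = r ^+ m.
  by rewrite -powR_mulrn ?powR_ge0 // /r -powRrM; congr (_ `^ _); field.
have r4 : r ^+ 4 = n%:R by rewrite -rpow divff ?powRr1 // pnatr_eq0.
(* An integer between [r] and [r + 1], hence at most [2 r] as [r >= 1]. *)
pose L := (Num.truncn r).+1.
have rL : r <= L%:R by rewrite ltW // truncnS_gt.
have L2r : L%:R <= 2 * r.
  have /andP[+ _] := truncn_itv (le_trans ler01 r1).
  rewrite /L -natr1; lra.
have [M hM HM] := almost_balanced_matching (ltn0Sn (Num.truncn r)) hull0.
exists M => //; rewrite /= -/L in HM; set F := l1norm _ in HM *.
have F0 : 0 <= F by exact: sumr_ge0.
have FA : F <= 2 * k%:R ^+ 2 * r ^+ 3.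
  apply: (sqr_bound_le k4 r1 rL L2r F0); rewrite r4.
  by move: HM; rewrite card_ord !natrM; lra.
have kpow : k%:R ^+ 2 <= k%:R `^ (11 / 4) :> R.
  by rewrite -powR_mulrn //; apply: ler_powR; lra.
have lnk := half_le_sqrt_ln (x := 2 * k%:R : R) ltac:(lra).
rewrite rpow; apply: le_trans FA _.
(* The logarithmic factor is at least [1 / 2], and [13 / 2] exceeds the constant 2 of [FA]. *)
apply: le_trans (_ : 13 * k%:R `^ (11 / 4) * r ^+ 3 * (1 / 2) <= _); last first.
  by rewrite ler_wpM2l // !mulr_ge0 ?powR_ge0 // exprn_ge0 // powR_ge0.
have : k%:R ^+ 2 * r ^+ 3 <= k%:R `^ (11 / 4) * r ^+ 3.
  by rewrite ler_wpM2r // exprn_ge0 // powR_ge0.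
have : 0 <= k%:R ^+ 2 * r ^+ 3 by rewrite mulr_ge0 ?exprn_ge0 // powR_ge0.
lra.
Qed.
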